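(* Let $A \in \mathcal M_d(\mathbb R)$ and let $\tau$ be a delay function such that $\inf_{s \in [0, t]} \tau(s) > 0$ for every $t \geq 0$ and such that, with $\sigma_1(t) = t - \tau(t)$, $\mathcal L(\sigma_1^{-1}(N)) = 0$ for every Lebesgue-measurable $N \subset \mathbb R$ with $\mathcal L(N) = 0$. Let $\mathbf n\colon \mathbb R \to \mathbb N$ be the associated function counting iterations. If $x$ is an a.e. solution of $$x(t) = A x(t - \tau(t)), \qquad t \geq 0,$$ with initial condition equal to $x_0\colon \lvert -h(0), 0) \to \mathbb R^d$ a.e., then $$x(t) = A^{\mathbf n(t)} x_0(\sigma_{\mathbf n(t)}(t)) \qquad \text{for almost every } t \in \mathbb R_+.$$ In particular, one has uniqueness of solutions with respect to a.e. equality: if $x_1, x_2\colon \lvert -h(0), +\infty) \to \mathbb R^d$ are a.e. solutions with $x_1(t) = x_2(t)$ for a.e. $t \in \lvert -h(0), 0)$, then $x_1(t) = x_2(t)$ for a.e. $t \in \lvert -h(0), +\infty)$.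
   Context: $\mathbb R_+ = [0, +\infty)$, $\mathbb R_+^\ast = (0, +\infty)$, $\mathbb N = \{0, 1, 2, \dots\}$; $\mathcal M_d(\mathbb R)$ is the set of real $d \times d$ matrices, $d$ a positive integer; $\mathcal L$ is Lebesgue measure. For $a \leq b$ in $\mathbb R \cup \{\pm\infty\}$, $\lvert a, b)$ denotes $[a, b)$ if $a > -\infty$ and $(a, b)$ if $a = -\infty$. A \emph{delay function} is any function $\tau\colon \mathbb R_+ \to \mathbb R_+^\ast$. Its \emph{largest delay function} is $h\colon \mathbb R_+ \to \mathbb R_+^\ast \cup \{+\infty\}$, $h(t) = t - \inf_{s \in [t, +\infty)} (s - \tau(s))$. An \emph{almost everywhere (a.e.) solution} of the equation is a function $x\colon \lvert -h(0), +\infty) \to \mathbb R^d$ such that, for every function $\widetilde x\colon \lvert -h(0), +\infty) \to \mathbb R^d$ equal to $x$ almost everywhere, we have $\widetilde x(t) = A \widetilde x(t - \tau(t))$ for almost every $t \in \mathbb R_+$. (No measurability of $x$ is required.) Its \emph{initial condition} is its restriction to $\lvert -h(0), 0)$. Iterated delay functions $\sigma_n\colon D_n \to \mathbb R$: $D_0 = \mathbb R$, $\sigma_0(t) = t$, and, for $n \geq 1$, $D_n = \{t \in \mathbb R_+ \mid t - \tau(t) \in D_{n-1}\}$ and $\sigma_n(t) = \sigma_{n-1}(t - \tau(t))$ for $t \in D_n$. Under the condition $\inf_{[0,t]} \tau > 0$ for every $t \geq 0$, there is a unique function $\mathbf n\colon \mathbb R \to \mathbb N$ such that $t \in D_{\mathbf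 n(t)} \setminus D_{\mathbf n(t) + 1}$ for every $t \in \mathbb R$, and one has $\sigma_{\mathbf n(t)}(t) \in \lvert -h(0), 0)$ for every $t \in \mathbb R_+$. *)

(* Defs.v *)
From HB Require Import structures.
From mathcomp Require Import all_boot all_order all_algebra.
From mathcomp Require Import all_classical all_reals all_analysis.

Set Implicit Arguments.
Unset Strict Implicit.
Unset Printing Implicit Defensive.
Import Order.TTheory GRing.Theory Num.Theory.
Local Open Scope classical_set_scope.
Local Open Scope ring_scope.

(* Functions on a subset of R (delay functions on [0, +oo[, solutions on
   |-h(0), +oo), initial conditions on |-h(0), 0)) are total functions on R of
   which only the values on that subset are used. *)

Section Delay.
Context {R : realType}.
Implicit Types (tau : R -> R) (t : R) (n : nat).

Definition delay_function tau := forall t, 0 <= t -> 0 < tau t.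

(* The interval |a, b): as a set of reals, it excludes a exactly when a = -oo. *)
Definition co_itv (a b : \bar R) : set R := [set t | (a <= t%:E < b)%E].

Definition largest_delay tau t : \bar R :=
  (t%:E - ereal_inf [set (s - tau s)%:E | s in `[t, +oo[])%E.

Definition solution_domain tau : set R := co_itv (- largest_delay tau 0)%E +oo%E.

Definition initial_domain tau : set R := co_itv (- largest_delay tau 0)%E 0%E.

Fixpoint iter_domain tau n : set R :=
  if n is m.+1 then [set t | 0 <= t /\ iter_domain tau m (t - tau t)]
  else setT.

(* sigma_n, meaningful on D_n = iter_domain tau n only. *)
Fixpoint iter_delay tau n t : R :=
  if n is m.+1 then iter_delay tau m (t - tau t) else t.

(* The n with t in D_n \ D_(n+1); see num_iterP and num_iter_uniq. *)
Definition num_iter tau t : nat :=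
  xget 0%N [set n | (iter_domain tau n `\` iter_domain tau n.+1) t].

Definition inf_delay_gt0 tau :=
  forall t, 0 <= t -> 0 < inf [set tau s | s in `[0, t]].

(* sigma_1 is defined on [0, +oo[ only, hence the intersection. Since
   [lebesgue_measure] lives on the Borel sets, [negligible] (contained in a
   Borel set of measure 0) is "Lebesgue-measurable with measure 0". *)
Definition null_preimage tau := forall N : set R,
  (@lebesgue_measure R).-negligible N ->
  (@lebesgue_measure R).-negligible
    (`[0, +oo[ `&` iter_delay tau 1%N @^-1` N).

Definition ae_solution d (A : 'M[R]_d) tau (x : R -> 'cV[R]_d) :=
  forall y : R -> 'cV[R]_d,
    y = x %[ae (@lebesgue_measure R) in solution_domain tau] ->
    {ae (@lebesgue_measure R), forall t, 0 <= t -> y t = A *m y (t - tau t)}.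

Lemma delayed_in_solution_domain tau t :
  0 <= t -> solution_domain tau (t - tau t).
Proof.
move=> t0; rewrite /solution_domain /co_itv /= ltry andbT /largest_delay.
rewrite sub0e oppeK; apply: ereal_inf_lbound; exists t => //=.
by rewrite in_itv /= t0.
Qed.

Lemma iter_domain_decr tau n t : iter_domain tau n.+1 t -> iter_domain tau n t.
Proof. by elim: n t => [//|n IH] t [t0 /IH]. Qed.

Lemma iter_domain_le tau m n t :
  (m <= n)%N -> iter_domain tau n t -> iter_domain tau m t.
Proof.
elim: n => [|n IH]; first by rewrite leqn0 => /eqP ->.
by rewrite leq_eqVlt => /predU1P[-> //|/IH h /iter_domain_decr].
Qed.

Lemma num_iter_uniq tau t m n :
  (iter_domain tau m `\` iter_domain tau m.+1) t ->
  (iter_domain tau n `\` iter_domain tau n.+1) t -> m = n.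
Proof.
move=> [m1 m2] [n1 n2]; apply/eqP; rewrite eqn_leq; apply/andP; split.
  by rewrite leqNgt; apply/negP => /iter_domain_le /(_ m1).
by rewrite leqNgt; apply/negP => /iter_domain_le /(_ n1).
Qed.

Lemma num_iterP tau t : delay_function tau -> inf_delay_gt0 tau ->
  (iter_domain tau (num_iter tau t) `\` iter_domain tau (num_iter tau t).+1) t.
Proof.
move=> tau0 infP; suff: exists n, (iter_domain tau n `\` iter_domain tau n.+1) t.
  by move=> ex; exact: (@xgetPex _ 0%N _ ex).
apply: contrapT => noex.
have all_in n : iter_domain tau n t.
  elim: n => [//|n IH]; apply: contrapT => h; apply: noex; exists n; split=> //.
have [t0 _] := all_in 1%N.
have e0 := infP t t0; set e := inf _ in e0.
have tau_ge s : 0 <= s <= t -> e <= tau s.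
  move=> sI; apply: ge_inf; last by exists s => //=; rewrite in_itv.
  by exists 0 => _ [u /= + <-]; rewrite in_itv /= => /andP[/tau0 /ltW].
have bound n s : s <= t -> iter_domain tau n.+1 s -> n%:R * e <= s.
  elim: n s => [|n IH] s st [s0]; first by rewrite mul0r.
  have le_e := tau_ge s; rewrite s0 st in le_e; have {}le_e := le_e isT.
  move=> /IH h; rewrite -natr1 mulrDl mul1r.
  have {}h : n%:R * e <= s - tau s.
    by apply: h; apply: le_trans st; rewrite gerBl ltW // tau0.
  by rewrite -lerBrDr; apply: (le_trans h); rewrite lerB.
have [n nt] : exists n, t / e < n%:R.
  by exists (Num.bound (t / e)); apply: le_lt_trans (archi_boundP _); rewrite ?divr_ge0 // ltW.
have := bound n t (lexx _) (all_in n.+1).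
by rewrite leNgt -ltr_pdivrMr // nt.
Qed.

End Delay.

(* Main.v *)
(* Let [B] be the null set of the [t >= 0] violating the equation together with
   those [t] of the initial interval at which [x] and [x0] differ. Since
   [sigma_1] pulls null sets back to null sets, the set of the [t] having some
   iterate [sigma_n t] in [B] is null; for any other [t], the equation can be
   applied along the whole orbit of [t] until it reaches the initial interval. *)
Require Import Defs.
From mathcomp Require Import all_boot all_order all_algebra.
From mathcomp Require Import all_classical all_reals all_analysis.

Set Implicit Arguments.
Unset Strict Implicit.
Unset Printing Implicit Defensive.
Import Order.TTheory GRing.Theory Num.Theory.
Local Open Scope classical_set_scope.
Local Open Scope ring_scope.

(** Induction on [n]: the set for [n.+1] lies in the part in [[0, +oo[] of the preimage under
    [sigma_1] of the set for [n], so [null_preimage] applies once per step. *)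
Lemma negligible_iter_delay (R : realType) (tau : R -> R) (B : set R) n :
  null_preimage tau -> (@lebesgue_measure R).-negligible B ->
  (@lebesgue_measure R).-negligible
    (iter_domain tau n `&` iter_delay tau n @^-1` B).
Proof.
move=> tau_null B0; elim: n => [|n IH]; first by rewrite /= setTI.
apply: negligibleS (tau_null _ IH) => t [[t0 Dt] Bt].
by split=> //=; rewrite in_itv /= t0.
Qed.

Lemma solution_domain_lt0 (R : realType) (tau : R -> R) (t : R) :
  t < 0 -> solution_domain tau t -> initial_domain tau t.
Proof.
move=> t0; rewrite /solution_domain /initial_domain /co_itv /=.
by move=> /andP[-> _]; rewrite lte_fin.
Qed.

Lemma solution_domain_ge0 (R : realType) (tau : R -> R) (t : R) :
  delay_function tau -> 0 <= t -> solution_domain tau t.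
Proof.
(* The point [0 - tau 0] is in the domain and negative, so the left end of the domain lies below
   every [t >= 0]. *)
move=> tau_delay t0; have := delayed_in_solution_domain tau (lexx 0).
rewrite /solution_domain /co_itv /= !ltry !andbT sub0r => /le_trans; apply.
by rewrite lee_fin (le_trans _ t0)// oppr_le0 ltW // tau_delay.
Qed.

(** Both hypotheses concern only the orbit of [t]. The [k]-th iterate of [t - tau t] is the
    [k.+1]-th of [t], so they pass to [t - tau t] and induction on [n] goes through. *)
Lemma iter_equation (R : realType) (d : nat) (A : 'M[R]_d) (tau : R -> R)
    (x x0 : R -> 'cV[R]_d) n t :
  (forall k, iter_domain tau k t -> 0 <= iter_delay tau k t ->
     x (iter_delay tau k t) =
       A *m x (iter_delay tau k t - tau (iter_delay tau k t))) ->
  (forall k, iter_domain tau k t -> initial_domain tau (iter_delay tau k t) ->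
     x (iter_delay tau k t) = x0 (iter_delay tau k t)) ->
  solution_domain tau t ->
  (iter_domain tau n `\` iter_domain tau n.+1) t ->
  x t = A ^+ n *m x0 (iter_delay tau n t).
Proof.
elim: n t => [|n IH] t xA xx0 St [Dt nDt].
  rewrite expr0 mul1mx; apply: (xx0 0%N) => //=.
  (* Since [D_0] is all of [R], being outside [D_1] means [t < 0]. *)
  apply: solution_domain_lt0 => //; rewrite ltNge; apply/negP => t0.
  by apply: nDt; split.
have [t0 Dt'] := Dt.
rewrite exprS -mulmxA (xA 0%N) //=; congr (_ *m _); apply: IH => [k Dk|k Dk||].
- exact: (xA k.+1).
- exact: (xx0 k.+1).
- exact: delayed_in_solution_domain.
- by split=> // Dn; apply: nDt; split.
Qed.

Lemma ae_solution_representation (R : realType) (d : nat) (A : 'M[R]_d)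
    (tau : R -> R) (x x0 : R -> 'cV[R]_d) :
  delay_function tau -> inf_delay_gt0 tau -> null_preimage tau ->
  ae_solution A tau x ->
  x = x0 %[ae (@lebesgue_measure R) in initial_domain tau] ->
  {ae (@lebesgue_measure R), forall t, 0 <= t ->
     x t = A ^+ num_iter tau t *m x0 (iter_delay tau (num_iter tau t) t)}.
Proof.
move=> tau_delay tau_inf tau_null solx xx0.
(* Among the a.e. modifications of [x], [x] itself is enough here. *)
have {}solx := solx x (ae_eq_refl _ _ _).
pose B1 : set R := ~` [set t | 0 <= t -> x t = A *m x (t - tau t)].
pose B2 : set R := ~` [set t | initial_domain tau t -> x t = x0 t].
have B_null : (@lebesgue_measure R).-negligible (B1 `|` B2).
  exact: negligibleU.
(* The exceptional set is covered by countably many null sets, one for each [k] at which the orbit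
   may hit [B1] or [B2]. *)
apply: negligibleS (negligible_bigcup
  (fun k => negligible_iter_delay k tau_null B_null)).
apply: subsetCl => t orbit_notB /= t_ge0.
have orbit k : iter_domain tau k t -> ~ (B1 `|` B2) (iter_delay tau k t).
  by move=> Dk Bk; apply: orbit_notB; exists k.
apply: iter_equation.
- by move=> k /orbit/not_orP[/contrapT].
- by move=> k /orbit/not_orP[_ /contrapT].
- exact: solution_domain_ge0.
- exact: num_iterP.
Qed.

Theorem theorem4p14 (R : realType) (d : nat) (d_gt0 : (0 < d)%N)
    (A : 'M[R]_d) (tau : R -> R)
    (tau_delay : delay_function tau)
    (tau_inf : inf_delay_gt0 tau)
    (tau_null : null_preimage tau) :
  (forall x x0 : R -> 'cV[R]_d,
     ae_solution A tau x ->
     x = x0 %[ae (@lebesgue_measure R) in initial_domain tau] ->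
     {ae (@lebesgue_measure R), forall t, 0 <= t ->
        x t = A ^+ num_iter tau t *m x0 (iter_delay tau (num_iter tau t) t)})
  /\
  (forall x1 x2 : R -> 'cV[R]_d,
     ae_solution A tau x1 ->
     ae_solution A tau x2 ->
     x1 = x2 %[ae (@lebesgue_measure R) in initial_domain tau] ->
     x1 = x2 %[ae (@lebesgue_measure R) in solution_domain tau]).
Proof.
have repr x x0 := @ae_solution_representation R d A tau x x0
  tau_delay tau_inf tau_null.
split=> [//|x1 x2 sol1 sol2 x12].
(* Both solutions are represented with the same initial condition, [x2]. *)
have r1 := repr _ _ sol1 x12.
have r2 := repr _ _ sol2 (ae_eq_refl _ _ _).
apply: (@filterS3 _ _ (ae_filter_ringOfSetsType _)) x12 r1 r2.
move=> t x12t r1t r2t St.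
have [t0|t0] := leP 0 t; first by rewrite r1t // r2t.
exact/x12t/solution_domain_lt0.
Qed.
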